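(* Let $\Gamma$ be a finite simplicial graph and let $\Lambda$ be an induced subgraph of $\Gamma$. Let $H$ be a parabolic subgroup of the right-angled Coxeter group $G_\Gamma$ induced by $\Lambda$, i.e. $H=gG_\Lambda g^{-1}$ for some $g\in G_\Gamma$. Then $H$ is almost malnormal in $G_\Gamma$ if and only if no vertex of $\Gamma-\Lambda$ commutes with two non-adjacent vertices of $\Lambda$.
   Context: Right-angled Coxeter group: for a finite simplicial graph $\Gamma$ with vertex set $S$, $G_\Gamma$ is the group generated by $S$ with relations $s^2=1$ for all $s\in S$ and $st=ts$ whenever $s,t$ are adjacent vertices. For an induced subgraph $\Lambda$ of $\Gamma$, the special subgroup $G_\Lambda$ is the subgroup of $G_\Gamma$ generated by the vertices of $\Lambda$; any conjugate of it is called a parabolic subgroup (induced by $\Lambda$). Almost malnormal: a subgroup $H\le G$ is almost malnormal if $gHg^{-1}\cap H$ is finite for each $g\in G\setminus H$. ''Two non-adjacent vertices'' means two distinct vertices not joined by an edge; the condition says that no single vertex of $\Gamma-\Lambda$ commutes with both. *)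

(* Defs.v *)
From HB Require Import structures.
From mathcomp Require Import all_boot.
From mathcomp Require Import boolp classical_sets functions cardinality.

Set Implicit Arguments.
Unset Strict Implicit.
Unset Printing Implicit Defensive.

Local Open Scope group_scope.
Local Open Scope quotient_scope.
Local Open Scope classical_set_scope.

(* The letter [(s, false)] stands for the generator [s], and [(s, true)] for  *)
(* its formal inverse.                                                        *)
Definition word (S : Type) := seq (S * bool).

Definition letter_inv (S : Type) (x : S * bool) : S * bool := (x.1, ~~ x.2).

Definition word_inv (S : Type) (w : word S) : word S :=
  rev (map (@letter_inv S) w).

(* [pres_eq R u v] : the words [u] and [v] represent the same element of the  *)
(* group < S | l = r for all l, r such that R l r >.                          *)
Inductive pres_eq (S : Type) (R : word S -> word S -> Prop) :
    word S -> word S -> Prop :=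
| pres_eq_refl u : pres_eq R u u
| pres_eq_sym u v : pres_eq R u v -> pres_eq R v u
| pres_eq_trans v u w : pres_eq R u v -> pres_eq R v w -> pres_eq R u w
| pres_eq_cancel u v x : pres_eq R (u ++ [:: x; letter_inv x] ++ v) (u ++ v)
| pres_eq_rel u v l r : R l r -> pres_eq R (u ++ l ++ v) (u ++ r ++ v).

Section PresentedGroup.
Variables (S : choiceType) (R : word S -> word S -> Prop).

Definition pres_eqb (u v : word S) : bool := `[< pres_eq R u v >].

Lemma pres_eqb_refl : reflexive pres_eqb.
Proof. by move=> u; apply/asboolP/pres_eq_refl. Qed.

Lemma pres_eqb_sym : symmetric pres_eqb.
Proof. by move=> u v; apply/asboolP/asboolP => /pres_eq_sym. Qed.

Lemma pres_eqb_trans : transitive pres_eqb.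
Proof.
by move=> v u w /asboolP uv /asboolP vw; apply/asboolP/(pres_eq_trans uv vw).
Qed.

Canonical pres_eqb_equiv : equiv_rel (word S) :=
  EquivRel pres_eqb pres_eqb_refl pres_eqb_sym pres_eqb_trans.

Definition presented_group := {eq_quot pres_eqb_equiv}.

HB.instance Definition _ := Choice.on presented_group.
HB.instance Definition _ := EqQuotient.on presented_group.

Definition word_class (w : word S) : presented_group := \pi w.

Definition pres_gen (s : S) : presented_group := word_class [:: (s, false)].

Definition pres_one : presented_group := word_class [::].

Definition pres_mul (x y : presented_group) : presented_group :=
  word_class (repr x ++ repr y).

Definition pres_inv (x : presented_group) : presented_group :=
  word_class (word_inv (repr x)).

Lemma word_classP u v : word_class u = word_class v <-> pres_eq R u v.
Proof.
split => [/eqP|uv]; first by rewrite eqmodE => /asboolP.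
by apply/eqP; rewrite eqmodE; apply/asboolP.
Qed.

Lemma repr_word_class u : pres_eq R (repr (word_class u)) u.
Proof. by apply/word_classP; rewrite /word_class reprK. Qed.

Lemma word_classK x : word_class (repr x) = x.
Proof. exact: reprK. Qed.

Lemma pres_eq_cat2 u v a b :
  pres_eq R u v -> pres_eq R (a ++ u ++ b) (a ++ v ++ b).
Proof.
elim=> [w|w1 w2 _|w2 w1 w3 _ + _|u1 v1 x|u1 v1 l r lr].
- exact: pres_eq_refl.
- exact: pres_eq_sym.
- exact: pres_eq_trans.
- rewrite -!(catA u1) !(catA a u1) -!(catA _ v1).
  exact: (pres_eq_cancel R (a ++ u1) (v1 ++ b)).
- rewrite -!(catA u1) !(catA a u1) -!(catA _ v1).
  exact: pres_eq_rel.
Qed.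

Lemma pres_eq_cat u u' v v' :
  pres_eq R u u' -> pres_eq R v v' -> pres_eq R (u ++ v) (u' ++ v').
Proof.
move=> uu' vv'; apply: (@pres_eq_trans _ _ (u' ++ v)).
  exact: (pres_eq_cat2 [::] v uu').
by have := pres_eq_cat2 u' [::] vv'; rewrite !cats0.
Qed.

Lemma word_class_cat u v :
  word_class (u ++ v) = pres_mul (word_class u) (word_class v).
Proof.
by apply/word_classP/pres_eq_sym/pres_eq_cat; apply: repr_word_class.
Qed.

Lemma pres_eq_wordV u : pres_eq R (u ++ word_inv u) [::].
Proof.
elim: u => [|x u IHu]; first exact: pres_eq_refl.
apply: (@pres_eq_trans _ _ ([:: x] ++ [:: letter_inv x])).
  have := pres_eq_cat2 [:: x] [:: letter_inv x] IHu.
  by rewrite /word_inv map_cons rev_cons -cats1 -!catA.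
exact: (pres_eq_cancel R [::] [::]).
Qed.

Lemma word_invK : involutive (@word_inv S).
Proof.
move=> u; rewrite /word_inv map_rev revK -map_comp map_id_in // => -[s b] _.
by rewrite /= /letter_inv /= negbK.
Qed.

Lemma pres_eq_Vword u : pres_eq R (word_inv u ++ u) [::].
Proof. by have := pres_eq_wordV (word_inv u); rewrite word_invK. Qed.

Lemma pres_mulA : associative pres_mul.
Proof.
move=> x y z; rewrite -(word_classK x) -(word_classK y) -(word_classK z).
by rewrite -!word_class_cat catA.
Qed.

Lemma pres_mul1 : left_id pres_one pres_mul.
Proof. by move=> x; rewrite -(word_classK x) -word_class_cat. Qed.

Lemma pres_mulr1 : right_id pres_one pres_mul.
Proof. by move=> x; rewrite -(word_classK x) -word_class_cat cats0. Qed.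

Lemma pres_mulV : left_inverse pres_one pres_inv pres_mul.
Proof.
move=> x; rewrite -{2}(word_classK x) -word_class_cat.
exact/word_classP/pres_eq_Vword.
Qed.

Lemma pres_mulrV : right_inverse pres_one pres_inv pres_mul.
Proof.
move=> x; rewrite -{1}(word_classK x) -word_class_cat.
exact/word_classP/pres_eq_wordV.
Qed.

HB.instance Definition _ := isGroup.Build presented_group
  pres_mulA pres_mul1 pres_mulr1 pres_mulV pres_mulrV.

End PresentedGroup.

(* A finite simplicial graph is a symmetric irreflexive [adj] on a finType.   *)
Inductive racg_rel (S : finType) (adj : rel S) : word S -> word S -> Prop :=
| racg_sqr s : racg_rel adj [:: (s, false); (s, false)] [::]
| racg_comm s t : adj s t ->
    racg_rel adj [:: (s, false); (t, false)] [:: (t, false); (s, false)].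

Definition racg (S : finType) (adj : rel S) : groupType :=
  presented_group (racg_rel adj).

Definition racg_gen (S : finType) (adj : rel S) (s : S) : racg adj :=
  pres_gen (racg_rel adj) s.

Definition subgroup (G : groupType) (H : set G) : Prop :=
  [/\ H 1, forall x y, H x -> H y -> H (x * y) & forall x, H x -> H x^-1].

Definition subgroup_gen (G : groupType) (A : set G) : set G :=
  smallest (@subgroup G) A.

Definition conj_set (G : groupType) (g : G) (H : set G) : set G :=
  (fun h => g * h * g^-1) @` H.

Definition almost_malnormal (G : groupType) (H : set G) : Prop :=
  forall g : G, ~ H g -> finite_set (conj_set g H `&` H).

(* An induced subgraph is given by its set of vertices [L].                   *)
Definition special_subgroup (S : finType) (adj : rel S) (L : {set S}) :
    set (racg adj) :=
  subgroup_gen (@racg_gen S adj @` [set` L]).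

Arguments special_subgroup {S} adj L.

Definition parabolic (S : finType) (adj : rel S) (L : {set S})
    (H : set (racg adj)) : Prop :=
  exists g : racg adj, H = conj_set g (special_subgroup adj L).

(* Main.v *)
Require Import Defs.
From mathcomp Require Import all_boot ssralg ssrint.
From mathcomp Require Import boolp classical_sets functions cardinality.

(* Count the reflections [v ^ r] contributed by the letters [v] outside [L] of *)
(* a word [p v r]. The parity [parity L g x] of the number of occurrences of   *)
(* [x] depends only on [g] and is a cocycle that vanishes on [G_L]; when two   *)
(* contributed reflections coincide, their letters can be deleted, so for [g]  *)
(* outside [G_L] some [x0 = v ^ m], with [m] in [G_L] and [v] outside [L], has *)
(* parity 1. If [h] and [k h k^-1] lie in [G_L], the cocycle rule shows that   *)
(* [h] permutes the finite set of [x] with [parity L k x = 1]. Hence           *)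
(* [k G_L k^-1 :&: G_L] is finite as soon as the centralizer of [v] in [G_L]   *)
(* is. The same cocycle shows that this centralizer is generated by the        *)
(* vertices of [L] commuting with [v]; if these commute pairwise it is finite. *)
(* Conversely, if [v] outside [L] commutes with nonadjacent [a], [b] in [L],   *)
(* then [v G_L v^-1 :&: G_L] contains the powers of [b a], which are distinct  *)
(* because [a], [b] act on the integers as an infinite dihedral group.         *)

Set Implicit Arguments.
Unset Strict Implicit.
Unset Printing Implicit Defensive.

Import GRing.Theory.

Local Open Scope group_scope.

Lemma conjg_eqL (G : groupType) (x y z : G) : (x ^ y == z) = (x == z ^ y^-1).
Proof. exact: can2_eq (conjgK y) (conjgKV y) x z. Qed.

Lemma commute_conjg (G : groupType) (x y : G) : commute x y -> x ^ y = x.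
Proof. by move=> xy; rewrite conjgE xy mulKg. Qed.

(** * Actions defined on the generators *)

Section WordAction.
Variables (S : finType) (adj : rel S) (T : Type) (f : S -> T -> T).
Hypothesis f_invol : forall s, involutive (f s).
Hypothesis f_comm : forall s t x, adj s t -> f s (f t x) = f t (f s x).

(** The sign of a letter is ignored: [f s] is an involution, so a generator and its formal inverse
    act alike. *)
Definition word_act (w : word S) (x : T) : T := foldr (fun l => f l.1) x w.

Lemma word_act_cat u v x : word_act (u ++ v) x = word_act u (word_act v x).
Proof. exact: foldr_cat. Qed.

Lemma word_act_pres_eq u v x :
  pres_eq (racg_rel adj) u v -> word_act u x = word_act v x.
Proof.
move=> uv; elim: uv x => {u v} [//|u v _ IH x|v u w _ IH1 _ IH2 x|u v l x
  |u v l r lr x].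
- by rewrite IH.
- by rewrite IH1 IH2.
- by rewrite !word_act_cat /= f_invol.
- rewrite !word_act_cat; congr word_act.
  by case: lr => [s|s t st] /=; rewrite ?f_invol // f_comm.
Qed.

Definition racg_act (g : racg adj) (x : T) : T := word_act (repr g) x.

Lemma racg_act_class w x :
  racg_act (word_class (racg_rel adj) w) x = word_act w x.
Proof. exact/word_act_pres_eq/repr_word_class. Qed.

Lemma racg_actM g h x : racg_act (g * h) x = racg_act g (racg_act h x).
Proof.
by rewrite /racg_act -word_act_cat; apply/word_act_pres_eq/repr_word_class.
Qed.

Lemma racg_act1 x : racg_act 1 x = x.
Proof. exact: (racg_act_class [::]). Qed.

Lemma racg_act_gen s x : racg_act (racg_gen adj s) x = f s x.
Proof. exact: racg_act_class. Qed.

End WordAction.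

Section Racg.
Variables (S : finType) (adj : rel S).
Implicit Types (s t v : S) (w p q r : seq S) (g h k x y : racg adj).
Implicit Types (A L M : {set S}).

Local Notation gen := (@racg_gen S adj).

(** * Words in the generators and special subgroups *)

Lemma racg_genK s : gen s * gen s = 1.
Proof.
rewrite /racg_gen /pres_gen -[LHS]word_class_cat; apply/word_classP.
exact: (@pres_eq_rel _ _ [::] [::] _ _ (racg_sqr adj s)).
Qed.

Lemma racg_genV s : (gen s)^-1 = gen s.
Proof. exact/mulg1_eq/racg_genK. Qed.

Lemma racg_gen_comm s t : adj s t -> commute (gen s) (gen t).
Proof.
move=> st; rewrite /commute /racg_gen /pres_gen.
rewrite -[LHS]word_class_cat -[RHS]word_class_cat; apply/word_classP.
exact: (@pres_eq_rel _ _ [::] [::] _ _ (racg_comm st)).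
Qed.

Definition racg_word w : racg adj := \prod_(s <- w) gen s.

Lemma racg_word_cons s w : racg_word (s :: w) = gen s * racg_word w.
Proof. exact: big_cons. Qed.

Lemma racg_word_cat p q : racg_word (p ++ q) = racg_word p * racg_word q.
Proof. exact: big_cat. Qed.

Lemma racg_wordV w : (racg_word w)^-1 = racg_word (rev w).
Proof.
elim: w => [|s w IH]; first by rewrite /racg_word big_nil invg1.
rewrite racg_word_cons invgM IH racg_genV rev_cons -cats1 racg_word_cat.
by congr (_ * _); rewrite /racg_word big_seq1.
Qed.


Lemma racg_class_letter s b :
  word_class (racg_rel adj) [:: (s, b)] = racg_gen adj s.
Proof.
case: b => //; rewrite -racg_genV; apply: (mulIg (gen s)); rewrite mulVg.
rewrite -[LHS]word_class_cat; apply/word_classP.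
exact: (pres_eq_cancel _ [::] [::] (s, true)).
Qed.

Lemma racg_word_surj g : exists w, g = racg_word w.
Proof.
rewrite -(word_classK g); elim: (repr g) => [|[s b] u [w IHu]].
  by exists [::]; rewrite /racg_word big_nil.
by exists (s :: w); rewrite racg_word_cons -IHu -(racg_class_letter s b)
  -[RHS]word_class_cat.
Qed.

Lemma racg_ind (P : racg adj -> Prop) :
  P 1 -> (forall s g, P g -> P (gen s * g)) -> forall g, P g.
Proof.
move=> P1 PM g; have [w ->] := racg_word_surj g.
elim: w => [|s w IHw]; first by rewrite /racg_word big_nil.
by rewrite racg_word_cons; apply: PM.
Qed.

(** Since generators are involutions, reversing a word inverts it, so unsigned words in [L] already
    form a subgroup. *)
Lemma special_subgroupP L g :
  special_subgroup adj L g <->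
  exists2 w, {subset w <= L} & g = racg_word w.
Proof.
split=> [|[w wL ->] A [[A1 AM _] AL]].
  move=> /(_ [set h | exists2 w, {subset w <= L} & h = racg_word w]%classic).
  apply; split; first split.
  - by exists [::] => //; rewrite /racg_word big_nil.
  - move=> _ _ [p pL ->] [q qL ->]; exists (p ++ q).
      by move=> s; rewrite mem_cat => /orP[/pL|/qL].
    by rewrite racg_word_cat.
  - move=> _ [w wL ->]; exists (rev w); last by rewrite racg_wordV.
    by move=> s; rewrite mem_rev => /wL.
  - move=> _ [s sL <-]; exists [:: s]; last by rewrite /racg_word big_seq1.
    by move=> t; rewrite inE => /eqP->.
elim: w wL => [_|s w IHw wL]; first by rewrite /racg_word big_nil.
rewrite racg_word_cons; apply: AM.
  by apply: AL; exists s => //; apply: wL; rewrite mem_head.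
by apply: IHw => t tw; apply: wL; rewrite inE tw orbT.
Qed.

Lemma special_subgroup_subgroup L : subgroup (special_subgroup adj L).
Proof.
split=> [A [[]]//|x y Lx Ly A AL|x Lx A AL].
  by case: (AL) => -[_ AM _] _; apply: AM; [apply: Lx|apply: Ly].
by case: (AL) => -[_ _ AV] _; apply: AV; apply: Lx.
Qed.

Lemma special_subgroup_gen L s : s \in L -> special_subgroup adj L (gen s).
Proof. by move=> sL A [_]; apply; exists s. Qed.

Lemma special_subgroup1 L : special_subgroup adj L 1.
Proof. by case: (special_subgroup_subgroup L). Qed.

Lemma special_subgroupM L x y :
  special_subgroup adj L x -> special_subgroup adj L y ->
  special_subgroup adj L (x * y).
Proof. by case: (special_subgroup_subgroup L) => _ + _; apply. Qed.

Lemma special_subgroupV L x :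
  special_subgroup adj L x -> special_subgroup adj L x^-1.
Proof. by case: (special_subgroup_subgroup L) => _ _; apply. Qed.

Lemma special_subgroupJ L x y :
  special_subgroup adj L x -> special_subgroup adj L y ->
  special_subgroup adj L (x ^ y).
Proof.
move=> Lx Ly; rewrite conjgE.
by do ![apply: special_subgroupM | apply: special_subgroupV].
Qed.

(** * The parity cocycle *)

(* [parity L g x] records whether the wall of the reflection [x], of type    *)
(* outside [L], is crossed an odd number of times along a word for [g]. Making *)
(* the group act on pairs (element, sign) gives independence of the word.     *)
Definition parity_step L s (xe : racg adj * bool) : racg adj * bool :=
  (xe.1 ^ gen s, xe.2 (+) ((s \notin L) && (xe.1 == gen s))).


Lemma parity_step_invol L s : involutive (parity_step L s).
Proof.
move=> [x e]; rewrite /parity_step /= -conjgM racg_genK conjg1.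
rewrite conjg_eqL racg_genV commute_conjg; last exact: commute_refl.
by rewrite addbK.
Qed.

(** Conjugation by either of two commuting generators fixes the other, so neither step affects the
    test made by the other. *)
Lemma parity_step_comm L s t xe : adj s t ->
  parity_step L s (parity_step L t xe) = parity_step L t (parity_step L s xe).
Proof.
move=> /racg_gen_comm st; case: xe => x e; rewrite /parity_step /=.
rewrite -!conjgM st !conjg_eqL !racg_genV (commute_conjg st).
by rewrite (commute_conjg (commute_sym st)) addbAC.
Qed.

Definition parity L g x : bool :=
  (racg_act (parity_step L) g (x, false)).2.

Lemma racg_act_parity L g x e :
  racg_act (parity_step L) g (x, e) = (x ^ g^-1, e (+) parity L g x).
Proof.
pose act1 := racg_act1 (parity_step_invol L) (@parity_step_comm L).
pose actM := racg_actM (parity_step_invol L) (@parity_step_comm L).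
pose actg := racg_act_gen (parity_step_invol L) (@parity_step_comm L).
elim/racg_ind: g x e => [x e|s g IHg x e].
  by rewrite /parity !act1 invg1 conjg1 addbF.
rewrite /parity !actM !IHg !actg /parity_step /= invgM racg_genV conjgM.
by rewrite addbA.
Qed.

Lemma parityM L g h x :
  parity L (g * h) x = parity L h x (+) parity L g (x ^ h^-1).
Proof.
rewrite {1}/parity racg_actM ?racg_act_parity //=.
  exact: parity_step_invol.
exact: parity_step_comm.
Qed.

Lemma parity_gen L s x : parity L (gen s) x = (s \notin L) && (x == gen s).
Proof.
rewrite /parity racg_act_gen //=; first exact: parity_step_invol.
exact: parity_step_comm.
Qed.

Lemma parity1 L x : parity L 1 x = false.
Proof.
rewrite /parity racg_act1 //=; first exact: parity_step_invol.
exact: parity_step_comm.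
Qed.

(** * Reflections of a word and deletion of letters *)

Fixpoint reflections L w : seq (racg adj) :=
  if w is s :: w' then
    if s \in L then reflections L w'
    else gen s ^ racg_word w' :: reflections L w'
  else [::].

Lemma parity_word L w x :
  parity L (racg_word w) x = odd (count_mem x (reflections L w)).
Proof.
elim: w => [|s w IHw] /=; first by rewrite /racg_word big_nil parity1.
rewrite racg_word_cons parityM parity_gen {}IHw.
case: ifP => _ /=; first by rewrite addbF.
by rewrite oddD oddb addbC conjg_eqL invgK eq_sym.
Qed.

Lemma mem_reflections L w x : x \in reflections L w ->
  exists p v r, [/\ w = p ++ v :: r, v \notin L & x = gen v ^ racg_word r].
Proof.
elim: w => [//|s w IHw] /=; case: (boolP (s \in L)) => [_|sL].
  by move=> /IHw[p [v [r [-> vL ->]]]]; exists (s :: p), v, r.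
rewrite inE => /orP[/eqP->|/IHw[p [v [r [-> vL ->]]]]].
  by exists [::], s, w.
by exists (s :: p), v, r.
Qed.

Lemma uniq_reflections L w : exists w',
  [/\ {subset w' <= w}, racg_word w' = racg_word w & uniq (reflections L w')].
Proof.
(* The deleted word comes from the reduced tail [w0], not from [w], so the induction on length must
   also bound the size. *)
suff [w' []] : exists w', [/\ size w' <= size w, {subset w' <= w},
    racg_word w' = racg_word w & uniq (reflections L w')] by exists w'.
have [n] := ubnP (size w); elim: n w => // n IHn [_|s w].
  by exists [::].
rewrite ltnS => /= wn; have [w0 [sz0 sub0 eq0 uniq0]] := IHn w wn.
have [sL|sL] := boolP (s \in L).
  exists (s :: w0); rewrite /= sL; split=> //; last by rewrite !racg_word_cons eq0.
  by move=> t; rewrite !inE => /orP[->//|/sub0->]; rewrite orbT.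
have [|x_new] := boolP (gen s ^ racg_word w0 \in reflections L w0); last first.
  exists (s :: w0); rewrite /= (negPf sL) /= x_new uniq0.
  split=> //; last by rewrite !racg_word_cons eq0.
  by move=> t; rewrite !inE => /orP[->//|/sub0->]; rewrite orbT.
move=> /mem_reflections[q [v [r [w0E _ xE]]]].
have del : racg_word (q ++ r) = racg_word (s :: w).
  rewrite racg_word_cons -eq0 conjgC xE w0E !racg_word_cat racg_word_cons.
  by rewrite conjgE !mulgA mulgK -(mulgA _ (gen v) (gen v)) racg_genK mulg1.
have szqr : size (q ++ r) < size w0.
  by rewrite w0E !size_cat /= addnS.
have [|w' [sz sub eq u]] := IHn (q ++ r).
  exact: leq_ltn_trans (leq_trans (ltnW szqr) sz0) wn.
exists w'; split=> //.
- by rewrite (leq_trans sz) // (leq_trans (ltnW szqr)) // (leq_trans sz0).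
- move=> t /sub tqr; rewrite inE sub0 ?orbT // w0E.
  by move: tqr; rewrite !mem_cat inE => /orP[]->; rewrite ?orbT.
- by rewrite eq.
Qed.

Lemma parity_special L g x : special_subgroup adj L g -> parity L g x = false.
Proof.
move=> /special_subgroupP[w wL ->]; rewrite parity_word.
suff -> : reflections L w = [::] by [].
elim: w wL => //= s w IHw wL; rewrite wL ?mem_head // IHw // => t tw.
by apply: wL; rewrite inE tw orbT.
Qed.

(** An odd count is nonzero, so [x] is a reflection of every word for [g], in particular of one
    written in [A]. *)
Lemma parity_mem_special A L g x :
  special_subgroup adj A g -> parity L g x -> special_subgroup adj A x.
Proof.
move=> /special_subgroupP[w wA ->]; rewrite parity_word => odd_x.
have /mem_reflections[p [v [r [wE _ ->]]]] : x \in reflections L w.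
  by rewrite -has_pred1 has_count; case: count odd_x.
have vrA : {subset v :: r <= A}.
  by move=> t tvr; apply: wA; rewrite wE mem_cat tvr orbT.
apply: special_subgroupJ.
  by apply: special_subgroup_gen; apply: vrA; rewrite mem_head.
by apply/special_subgroupP; exists r => // t tr; apply: vrA; rewrite inE tr orbT.
Qed.

Lemma finite_parity L g : finite_set [set x | parity L g x]%classic.
Proof.
have [w ->] := racg_word_surj g; apply: sub_finite_set (finite_seq (reflections L w)).
move=> x /=; rewrite parity_word -has_pred1 has_count.
by case: count.
Qed.

Lemma last_nmem L w : ~~ all (mem L) w ->
  exists p v r, [/\ w = p ++ v :: r, v \notin L & {subset r <= L}].
Proof.
elim: w => //= s w IHw; rewrite negb_and.
have [/allP wL|/IHw[p [v [r [-> vL rL]]]] _] := boolP (all (mem L) w).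
  by rewrite orbF => sL; exists [::], s, w.
by exists (s :: p), v, r.
Qed.

(* In a word for [g] whose reflections are pairwise distinct, the last letter *)
(* outside [L] contributes a reflection which nothing can cancel.             *)
Lemma parity_witness A L g :
  special_subgroup adj A g -> ~ special_subgroup adj L g ->
  exists v h, [/\ v \in A, v \notin L, special_subgroup adj L h
                & parity L g (gen v ^ h)].
Proof.
move=> /special_subgroupP[w0 w0A ->] gL.
have [w [sub eqw u]] := uniq_reflections L w0; rewrite -eqw in gL *.
have /last_nmem[p [v [r [wE vL rL]]]] : ~~ all (mem L) w.
  by apply/negP => /allP wL; apply: gL; apply/special_subgroupP; exists w.
exists v, (racg_word r); split=> //.
- by apply/w0A/sub; rewrite wE mem_cat mem_head orbT.
- by apply/special_subgroupP; exists r.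
rewrite parity_word count_uniq_mem // oddb wE.
elim: p {wE} => [|s p IHp] /=; first by rewrite (negPf vL) mem_head.
by case: ifP => // _; rewrite inE IHp orbT.
Qed.

(** * Centralizers and almost malnormality *)

(** Commutation in the group replaces adjacency, so the two need not be compared. *)
Definition vertex_link L v : {set S} :=
  [set s in L | `[< commute (gen v) (gen s) >]].

(** If [h] were outside the subgroup of the link [M], some [s ^ m] with [s] in [L] but not in [M]
    would have odd parity for [h]. As [v] commutes with [h] and [m], so would [(s ^ v) ^ m], which
    puts [s ^ v] in the subgroup of [L]; this forces [v] to commute with [s]. *)
Lemma centralizer_special L v h : v \notin L ->
  special_subgroup adj L h -> commute (gen v) h ->
  special_subgroup adj (vertex_link L v) h.
Proof.
move=> vL Lh vh; set M := vertex_link L v.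
have vM : v \notin M by rewrite inE (negPf vL).
(* The cocycle rule on both sides of [v h = h v]; the contributions of [v] agree because
   [v ^ h = v]. *)
have parity_conj x : parity M h x = parity M h (x ^ gen v).
  have := parityM M h (gen v) x; rewrite -vh parityM !parity_gen vM /=.
  rewrite conjg_eqL invgK (commute_conjg vh) racg_genV [RHS]addbC.
  exact: addIb.
apply: contrapT => /(parity_witness Lh)[s [m [sL sM Mm ps]]].
have mv : commute m (gen v).
  case/special_subgroupP: Mm => w wM ->; apply: commute_sym.
  rewrite /racg_word big_seq; apply: commute_prod => t /wM.
  by rewrite inE => /andP[_ /asboolP].
have Lsv : special_subgroup adj L (gen s ^ gen v).
  have Lm : special_subgroup adj L m.
    case/special_subgroupP: Mm => w wM ->; apply/special_subgroupP.
    by exists w => // t /wM; rewrite inE => /andP[].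
  rewrite -[_ ^ _](conjgK m); apply: special_subgroupJ.
    apply: (@parity_mem_special _ M _ _ Lh).
    by rewrite -conjgM -mv conjgM -parity_conj.
  exact: special_subgroupV.
suff vs : commute (gen v) (gen s) by rewrite inE sL asboolT in sM.
(* In [v s v] the right-hand [v] contributes the reflection [v]; parity 0 requires the left-hand one
   to contribute it too, that is, [v] to be fixed by conjugation by [s v]. *)
have := parity_special (gen v) Lsv.
rewrite conjgE racg_genV !parityM !parity_gen vL sL /= eqxx.
rewrite conjg_eqL invgK conjgM eq_sym conjg_eqL racg_genV => /negbFE.
rewrite (commute_conjg (commute_refl _)) conjg_fix.
exact: commgP.
Qed.

(** Letters [s] can be moved to the front and cancelled in pairs, so adding [s] to the list at most
    doubles the set. *)
Lemma finite_racg_words (l : seq S) :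
  {in l &, forall s t, commute (gen s) (gen t)} ->
  finite_set [set g | exists2 w, {subset w <= l} & g = racg_word w]%classic.
Proof.
elim: l => [_|s l IHl comm_l].
  apply: sub_finite_set (finite_set1 1) => _ [[|t w] wl ->] /=.
    by rewrite /racg_word big_nil.
  by have := wl t (mem_head t w).
set F := [set g | exists2 w, {subset w <= l} & g = racg_word w]%classic in IHl.
have finF : finite_set F.
  by apply: IHl => t u tl ul; apply: comm_l; rewrite inE ?tl ?ul orbT.
apply: (@sub_finite_set _ _ (F `|` (fun g => gen s * g) @` F)%classic); last first.
  by rewrite finite_setU; split=> //; apply: finite_image.
move=> _ [w wl ->]; elim: w wl => [_|t w IHw wl].
  by left; exists [::].
have {}IHw : (F `|` (fun g => gen s * g) @` F)%classic (racg_word w).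
  by apply: IHw => u uw; apply: wl; rewrite inE uw orbT.
rewrite racg_word_cons; have := wl t (mem_head t w).
rewrite inE => /predU1P[->|tl].
  case: IHw => [Fw|[g Fg <-]]; first by right; exists (racg_word w).
  by left; rewrite mulgA racg_genK mul1g.
have tF g : F g -> F (gen t * g).
  move=> [u ul ->]; exists (t :: u); last by rewrite racg_word_cons.
  by move=> z; rewrite inE => /predU1P[->//|/ul].
case: IHw => [Fw|[g Fg <-]]; first by left; apply: tF.
right; exists (gen t * g); first exact: tF.
rewrite !mulgA; congr (_ * _).
by apply: comm_l; rewrite inE ?eqxx ?tl ?orbT.
Qed.

Lemma finite_special_commuting M :
  {in M &, forall s t, commute (gen s) (gen t)} ->
  finite_set (special_subgroup adj M).
Proof.
move=> comm_M; apply: sub_finite_set (finite_racg_words (l := enum M) _).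
  by move=> _ /special_subgroupP[w wM ->]; exists w => // s /wM; rewrite mem_enum.
by move=> s t; rewrite !mem_enum; apply: comm_M.
Qed.

Lemma special_almost_malnormal L :
  (forall v, v \notin L ->
    {in vertex_link L v &, forall s t, commute (gen s) (gen t)}) ->
  almost_malnormal (special_subgroup adj L).
Proof.
move=> link_comm k Lk; set K := special_subgroup adj L.
have [w kw] := racg_word_surj k.
have Tk : special_subgroup adj [set: S] k.
  by apply/special_subgroupP; exists w => // s _; rewrite inE.
have {Tk} [v [m [_ vL Km pm]]] := parity_witness Tk Lk.
set x0 := gen v ^ m in pm.
pose D := [set h | K h /\ K (k * h * k^-1)]%classic.
suff finD : finite_set D.
  apply: sub_finite_set (finite_image (fun h => k * h * k^-1) finD).
  by move=> _ [[h Kh <-] Kkh]; exists h.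
pose N := [set x | parity L k x]%classic.
pose F y := [set h | K h /\ x0 ^ h^-1 = y]%classic.
apply: (@sub_finite_set _ _ (\bigcup_(y in N) F y)%classic).
  move=> h [Kh Kkh]; exists (x0 ^ h^-1) => //; rewrite /N /=.
  (* Both [h] and [k h k^-1] have zero parity, so parity 1 of [k] at [x0] passes to [x0 ^ h^-1]. *)
  have : parity L (k * h) x0 = parity L (k * h * k^-1 * k) x0 by rewrite mulgVK.
  rewrite (parityM L k) (parityM L (_ / _)) pm.
  by rewrite (parity_special _ Kh) (parity_special _ Kkh).
apply: bigcup_finite => [|y Ny]; first exact: finite_parity.
have [[h0 [Kh0 h0y]]|noh] := pselect (exists h, F y h); last first.
  by apply: sub_finite_set (finite_set0 _) => h Fh; apply: noh; exists h.
have finM := finite_special_commuting (link_comm v vL).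
(* A nonempty fibre lies in a coset of the centralizer of [x0 = v ^ m], which is the centralizer of
   [v] conjugated by [m]. *)
apply: sub_finite_set (finite_image (fun c => h0 * c ^ m) finM).
move=> h [Kh hy]; exists ((h0^-1 * h) ^ m^-1); last first.
  by rewrite conjgKV mulVKg.
apply: centralizer_special => //.
  apply: special_subgroupJ; last exact: special_subgroupV.
  by apply: special_subgroupM => //; apply: special_subgroupV.
have fix0 : x0 ^ (h0^-1 * h) = x0 by rewrite conjgM h0y -hy conjgKV.
apply/commgP; rewrite -conjg_fix -{1}[gen v](conjgK m) -/x0 -conjJg fix0.
by rewrite conjgK.
Qed.

(** * The obstruction from two non-adjacent vertices *)

Lemma malnormal_finite_powers L v a b : v \notin L ->
  a \in L -> b \in L -> commute (gen v) (gen a) -> commute (gen v) (gen b) ->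
  almost_malnormal (special_subgroup adj L) ->
  finite_set (range (fun n => (gen b * gen a) ^+ n)).
Proof.
move=> vL aL bL va vb amL.
have Lv : ~ special_subgroup adj L (gen v).
  by move=> /(parity_special (gen v)); rewrite parity_gen vL eqxx.
apply: sub_finite_set (amL _ Lv) => _ [n _ <-]; set x := _ ^+ n.
have Lx : special_subgroup adj L x.
  rewrite /x; elim: n {x} => [|n IHn]; first exact: special_subgroup1.
  rewrite expgS; do 2 ?apply: special_subgroupM => //;
    exact: special_subgroup_gen.
split=> //; exists x => //.
have -> : gen v * x = x * gen v by apply: commuteX; apply: commuteM.
by rewrite mulgK.
Qed.

Local Open Scope ring_scope.

(* The infinite dihedral group acting on the integers, [a] by [z |-> - z] and *)
(* [b] by [z |-> 1 - z].                                                      *)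
Definition dihedral_act a b s (z : int) : int :=
  if s == a then - z else if s == b then 1 - z else z.

Lemma infinite_powers_gen a b : symmetric adj -> a != b -> ~~ adj a b ->
  infinite_set (range (fun n => (gen b * gen a) ^+ n)%g).
Proof.
move=> adj_sym ab nab; pose f := dihedral_act a b.
have f_invol s : involutive (f s).
  move=> z; rewrite /f /dihedral_act.
  case: (s == a); first exact: opprK.
  by case: (s == b); first exact: subKr.
(* Every generator other than [a] and [b] acts trivially, and these two are adjacent in neither
   order. *)
have f_comm s t z : adj s t -> f s (f t z) = f t (f s z).
  rewrite /f /dihedral_act.
  case: (eqVneq s a) => [->|_]; last case: (eqVneq s b) => [->|_] //.
    case: (eqVneq t a) => [->//|_]; case: (eqVneq t b) => [->|//].
    by rewrite (negPf nab).
  case: (eqVneq t a) => [->|_]; first by rewrite adj_sym (negPf nab).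
  by case: ifP.
move=> /(finite_image (fun g => `|racg_act f g 0|%N)) fin.
apply: infinite_nat; apply: sub_finite_set fin => n _.
exists ((gen b * gen a) ^+ n)%g; first by exists n.
(* [b a] acts as the translation by 1, so its powers are told apart by the image of 0. *)
suff -> : racg_act f ((gen b * gen a) ^+ n)%g 0 = n%:Z by [].
elim: n => [|n IHn]; first by rewrite racg_act1.
rewrite expgS !racg_actM // IHn !racg_act_gen // /f /dihedral_act eqxx.
by rewrite eq_sym (negPf ab) eqxx opprK intS.
Qed.

End Racg.

(** * Passage to conjugates *)

(** Conjugation by [g] carries the intersection for [K] and [x ^ g] onto the one for [g K g^-1] and
    [x]. *)
Lemma almost_malnormal_conj (G : groupType) (g : G) (K : set G) :
  almost_malnormal K -> almost_malnormal (conj_set g K).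
Proof.
move=> amK x Kx; have Ky : ~ K (x ^ g).
  move=> Ky; apply: Kx; exists (x ^ g) => //.
  by rewrite conjgE !mulgA mulgV mul1g mulgK.
apply: sub_finite_set (finite_image (fun y => g * y * g^-1) (amK _ Ky)).
move=> _ [[_ [h Kh <-] <-] [h' Kh' e]]; exists h' => //; split=> //.
exists h => //; apply: (mulgI g); apply: (mulIg g^-1); rewrite e.
by rewrite conjgE !invgM invgK !mulgA mulgV mul1g !mulgK.
Qed.

Lemma conj_setK (G : groupType) (g : G) (K : set G) :
  conj_set g^-1 (conj_set g K) = K.
Proof.
apply/seteqP; split=> [_ [_ [h Kh <-] <-]|h Kh].
  by rewrite invgK !mulgA mulVg mul1g mulgVK.
exists (g * h * g^-1); first by exists h.
by rewrite invgK !mulgA mulVg mul1g mulgVK.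
Qed.

Theorem proposition1p7 (S : finType) (adj : rel S)
    (adj_sym : symmetric adj) (adj_irr : irreflexive adj)
    (L : {set S}) (H : set (racg adj)) (parH : parabolic L H) :
  almost_malnormal H <->
  ~ exists v a b : S,
      [/\ v \notin L, a \in L & b \in L] /\
      [/\ a != b, ~~ adj a b,
          commute (racg_gen adj v) (racg_gen adj a) &
          commute (racg_gen adj v) (racg_gen adj b)].
Proof.
case: parH => g ->; split=> [amH [v [a [b [[vL aL bL] [ab nab va vb]]]]]|no_v].
  have := @almost_malnormal_conj _ g^-1 _ amH; rewrite conj_setK.
  move=> /(malnormal_finite_powers vL aL bL va vb).
  exact: infinite_powers_gen.
apply/almost_malnormal_conj/special_almost_malnormal => v vL a b.
rewrite !inE => /andP[aL /asboolP va] /andP[bL /asboolP vb].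
(* Vertices of the link commute if equal or adjacent; the remaining case is the excluded
   configuration. *)
have [->|ab] := eqVneq a b; first exact: commute_refl.
have [/racg_gen_comm //|nab] := boolP (adj a b).
by case: no_v; exists v, a, b.
Qed.
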